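(* Let $q$ be a prime power, let $p$ be the characteristic of $\mathbb{F}_q$, let $n$ be a positive integer, and write $n=p^s n_0$ with $s\ge 0$ and $\gcd(n_0,p)=1$. Let $k$ be a non-negative integer with $k<n$, and let $d$ be the least positive integer such that $q^d\equiv 1 \pmod{n_0}$. For each positive integer $r$ let $v_r$ be the number of distinct monic irreducible factors of degree $r$ of $x^n-1$ over $\mathbb{F}_q$. Then the number $N_k$ of $k$-normal elements of $\mathbb{F}_{q^n}$ over $\mathbb{F}_q$ is $$N_k=\sum_{(\alpha_{r,i})\in\mathcal{A}_d}\ \prod_{r\mid d}\ \prod_{\substack{i=1\\ \alpha_{r,i}>0}}^{v_r} q^{r(\alpha_{r,i}-1)}(q^r-1),$$ where $\mathcal{A}_d$ is the set of tuples of integers $(\alpha_{r,i})$, indexed by the pairs $(r,i)$ with $r\mid d$ and $1\le i\le v_r$, such that $0\le\alpha_{r,i}\le p^s$ for all $(r,i)$ and $$\sum_{r\mid d} r\sum_{i=1}^{v_r}\alpha_{r,i}=n-k.$$ In particular, if $n$ is prime to $q$ (i.e. $n=n_0$), then $$N_k=\sum_{(a_r)\in A_d}\ \prod_{r\mid d}\binom{v_r}{a_r}(q^r-1)^{a_r},$$ where $A_d$ is the set of tuples of integers $(a_r)_{r\mid d}$ such that $\sum_{r\mid d} r a_r=n-k$ and $0\le a_r\le v_r$ for all $r\mid d$.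
   Context: For $\alpha\in\mathbb{F}_{q^n}$ put $g_\alpha(x)=\sum_{i=0}^{n-1}\alpha^{q^i}x^{n-1-i}\in\mathbb{F}_{q^n}[x]$. For $0\le k\le n-1$, the element $\alpha$ is called $k$-normal over $\mathbb{F}_q$ if $\gcd(x^n-1,g_\alpha(x))$, computed over $\mathbb{F}_{q^n}$, has degree $k$. Sums and products over $r\mid d$ run over the positive divisors $r$ of $d$. Empty products equal $1$ and empty sums equal $0$. *)

(* Defs.v *)
From mathcomp Require Import all_boot all_order all_algebra all_field.
From mathcomp Require Import qpoly.

Set Implicit Arguments.
Unset Strict Implicit.
Unset Printing Implicit Defensive.

Import GRing.Theory.
Local Open Scope ring_scope.

Definition g_poly (F : finFieldType) (L : fieldExtType F) (a : L) : {poly L} :=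
  \sum_(i < \dim {:L}) (a ^+ (#|F| ^ i)) *: 'X^(\dim {:L} - 1 - i).

(* The gcd is nonzero since 'X^n - 1 is, so its degree is its size minus one. *)
Definition is_knormal (F : finFieldType) (L : fieldExtType F)
    (k : nat) (a : L) : bool :=
  (size (gcdp ('X^(\dim {:L}) - 1) (g_poly a))).-1 == k.

Definition num_knormal (F : finFieldType) (L : fieldExtType F) (k : nat) : nat :=
  #|[set a : finvect_type L | is_knormal k (a : L)]|.

Definition num_irr_factors (F : finFieldType) (n r : nat) : nat :=
  #|[set f : {poly_r.+1 F} |
      [&& (f : {poly F}) \is monic, irreducibleb (f : {poly F}),
          size (f : {poly F}) == r.+1 & (f : {poly F}) %| 'X^n - 1]]|.

Notation divisor d := (seq_sub (divisors d)).

(* Tuples (alpha_{r,i}) with r | d, i < v r, and entries in {0, .., m}. *)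
Notation pair_tuple d m v :=
  {dffun forall r : divisor d, {ffun 'I_(v (val r)) -> 'I_m.+1}}.

(* Tuples (a_r) with r | d and 0 <= a_r <= v r. *)
Notation div_tuple d v :=
  {dffun forall r : divisor d, 'I_(v (val r)).+1}.

Definition pair_tuples (d m w : nat) (v : nat -> nat) : {set pair_tuple d m v} :=
  [set a : pair_tuple d m v |
    (\sum_(r : divisor d) val r * \sum_(i < v (val r)) a r i)%N == w].

Definition div_tuples (d w : nat) (v : nat -> nat) : {set div_tuple d v} :=
  [set a : div_tuple d v | (\sum_(r : divisor d) val r * a r)%N == w].

(* Main.v *)
(* Let Frobenius act on L as X, making L an F[X]-module killed by X^n - 1. Since
   g_(f a) = f g_a modulo X^n - 1, and since the gcd of X^n - 1 and g_a is
   Frobenius invariant up to a constant, (X^n - 1) / gcd is the order of a in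
   this module. Hence a is k-normal iff its order has degree n - k. A divisor f
   of X^n - 1 annihilates exactly q^(deg f) elements, because the linearized
   polynomial of f has at most that many roots and the same holds for
   (X^n - 1) / f. Writing the divisors as products of powers of the irreducible
   factors, which all have multiplicity p^s and degree dividing d, the number of
   elements of each order follows by inversion over the exponent tuples. *)
From HB Require Import structures.
Require Import Defs.
From mathcomp Require Import all_boot all_order all_algebra all_field.
From mathcomp Require Import qpoly zify.

Set Implicit Arguments.
Unset Strict Implicit.
Unset Printing Implicit Defensive.

Import GRing.Theory FalgLfun.
Local Open Scope ring_scope.

(** * Powers of the cardinality of a finite field *)

(** [#|F|] is a power of the characteristic, which [R] inherits as an [F]-algebra. This makes
    raising to the power [#|F| ^ i] additive in the extensions of [F] used below. *)
Lemma pnat_card_pchar (F : finFieldType) (R : lalgType F) i :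
  [pchar R].-nat (#|F| ^ i)%N.
Proof.
have [p p_pr pF] := finPcharP F.
have pR : p \in [pchar R].
  by rewrite inE p_pr -scaler_nat (pcharf0 pF) scale0r eqxx.
rewrite pnatX; apply/orP; left.
rewrite (eq_pnat _ (pcharf_eq pR)) -cardsT.
exact: (pprimeChar_pgroup (pF : p \in [pchar F])).
Qed.

Lemma expf_card_iter (F : finFieldType) i (c : F) : c ^+ (#|F| ^ i) = c.
Proof. by elim: i => // i IHi; rewrite expnSr exprM IHi expf_card. Qed.

(** * The Frobenius action of [F[X]] on [L] and the orders of elements *)

Section Frobenius.

Variables (F : finFieldType) (L : fieldExtType F).
Local Notation q := #|F|.
Local Notation n := (\dim {:L}).
Local Notation toL := (map_poly (in_alg L)).
Implicit Types (a b : L) (f u : {poly F}).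

Definition frob a : L := a ^+ q.

Fact frob_is_zmod_morphism : zmod_morphism frob.
Proof.
move=> a b; rewrite /frob exprDn_pchar ?exprNn_pchar //;
  by rewrite -[q]expn1 pnat_card_pchar.
Qed.

Fact frob_is_monoid_morphism : monoid_morphism frob.
Proof. by split=> [|a b]; rewrite /frob ?expr1n ?exprMn. Qed.

Fact frob_is_scalable : scalable frob.
Proof. by move=> c a; rewrite /frob exprZn expf_card. Qed.

HB.instance Definition _ :=
  GRing.isZmodMorphism.Build L L frob frob_is_zmod_morphism.
HB.instance Definition _ :=
  GRing.isMonoidMorphism.Build L L frob frob_is_monoid_morphism.
HB.instance Definition _ :=
  GRing.isScalable.Build F L L *:%R frob frob_is_scalable.

Definition frob_lfun : 'End(L) := linfun frob.

Definition frob_act f : 'End(L) := horner_alg frob_lfun f.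

Lemma frob_act0 a : frob_act 0 a = 0.
Proof. by rewrite /frob_act rmorph0 lfunE. Qed.

Lemma frob_actM f u a : frob_act (f * u) a = frob_act f (frob_act u a).
Proof. by rewrite /frob_act mulrC rmorphM /= lfun_mulE. Qed.

Lemma frob_actMXaddC f (c : F) a :
  frob_act (f * 'X + c%:P) a = frob_act f (frob a) + c *: a.
Proof.
rewrite /frob_act [f * 'X]mulrC rmorphD rmorphM /= horner_algX horner_algC.
rewrite add_lfunE.
by rewrite lfun_mulE scale_lfunE id_lfunE lfunE.
Qed.

Lemma ext_dim_gt0 : (0 < n)%N.
Proof. exact: adim_gt0. Qed.

Lemma expr_card_dim a : a ^+ (q ^ n) = a.
Proof. by apply/eqP; rewrite -Fermat's_little_theorem memvf. Qed.

Lemma frob_g_poly a : map_poly frob (g_poly a) = g_poly (frob a).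
Proof.
rewrite /g_poly rmorph_sum; apply: eq_bigr => i _ /=.
rewrite linearZ /= map_polyXn /frob -!exprM mulnC //.
Qed.

(** Multiplication by ['X] shifts the coefficients as Frobenius does. The top term [a *: 'X^n]
    overflows and the constant term of [g_poly (frob a)] is [a ^+ (q ^ n) = a], hence the
    correction. *)
Lemma mulX_g_poly a : 'X * g_poly a = g_poly (frob a) + a *: ('X^n - 1).
Proof.
rewrite /g_poly; case: n ext_dim_gt0 (expr_card_dim a) => // m _ am.
rewrite big_ord_recl big_ord_recr /= expr1 subn1 subn0 mulrDr.
rewrite -scalerAr -exprS subnn.
rewrite /frob -exprM -expnS am scalerBr addrACA expr0 subrr addr0 addrC.
congr (_ + _).
rewrite mulr_sumr; apply: eq_bigr => i _.
rewrite -exprM -expnS -scalerAr -exprS; congr (_ *: 'X^_).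
by rewrite /= -subSn ?subSS //; case: i.
Qed.

Lemma g_poly_is_linear (c : F) a b :
  g_poly (c *: a + b) = c%:A *: g_poly a + g_poly b.
Proof.
rewrite /g_poly scaler_sumr -big_split; apply: eq_bigr => i _ /=.
rewrite exprDn_pchar ?pnat_card_pchar // exprZn expf_card_iter.
by rewrite scalerDl scalerA mulr_algl.
Qed.

Lemma g_polyD a b : g_poly (a + b) = g_poly a + g_poly b.
Proof. by rewrite -{1}[a]scale1r g_poly_is_linear !scale1r. Qed.

Lemma g_poly0 : g_poly (0 : L) = 0.
Proof. by apply: (addrI (g_poly 0)); rewrite -g_polyD !addr0. Qed.

Lemma g_polyZ (c : F) a : g_poly (c *: a) = c%:A *: g_poly a.
Proof. by rewrite -{1}[_ *: a]addr0 g_poly_is_linear g_poly0 addr0. Qed.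

Lemma size_g_poly a : (size (g_poly a) <= n)%N.
Proof.
apply: (leq_trans (size_sum _ _ _)); apply/bigmax_leqP => i _.
apply: leq_trans (size_scale_leq _ _) _; rewrite size_polyXn.
by rewrite subn1 (leq_ltn_trans (leq_subr _ _)) ?ltn_predL ?ext_dim_gt0.
Qed.

Lemma coef_g_poly_predn a : (g_poly a)`_n.-1 = a.
Proof.
rewrite /g_poly; case: n ext_dim_gt0 => // m _; rewrite subn1 /=.
rewrite big_ord_recl coefD subn0 coefZ coefXn eqxx mulr1.
rewrite coef_sum big1 ?addr0 // => i _.
by rewrite coefZ coefXn -[X in X == _](subn0 m) eqn_sub2lE // ?mulr0 //=.
Qed.

Lemma size_Xn_sub1 : size ('X^n - 1 : {poly L}) = n.+1.
Proof. by rewrite size_XnsubC ?ext_dim_gt0. Qed.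

(** The degree of [g_poly a] is below [n] and its coefficient at [n - 1] is [a], so no nonzero [a]
    is lost modulo ['X^n - 1]. *)
Lemma Xn_sub1_dvd_g_poly a : ('X^n - 1 %| g_poly a) = (a == 0).
Proof.
apply/idP/eqP=> [dvd_g | ->]; last by rewrite g_poly0 dvdp0.
rewrite -(coef_g_poly_predn a) (_ : g_poly a = 0) ?coef0 //.
apply: contraTeq dvd_g => nz_g; apply/negP => /(dvdp_leq nz_g).
by rewrite size_Xn_sub1 ltnNge size_g_poly.
Qed.

(** Horner induction on [f]: constants act exactly, since [g_poly] is [F]-linear, and [mulX_g_poly]
    treats the factor ['X]. *)
Lemma g_poly_frob_act f a :
  'X^n - 1 %| g_poly (frob_act f a) - toL f * g_poly a.
Proof.
elim/poly_ind: f a => [|f c IHf] a.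
  by rewrite frob_act0 g_poly0 rmorph0 mul0r subrr dvdp0.
rewrite frob_actMXaddC g_polyD g_polyZ rmorphD rmorphM /= map_polyX map_polyC.
rewrite mulrDl mul_polyC opprD addrACA subrr addr0 -mulrA mulX_g_poly mulrDr.
by rewrite opprD addrA dvdp_subl ?IHf // -mul_polyC mulrA dvdp_mull.
Qed.

Lemma frob_act_eq0 f a :
  (frob_act f a == 0) = ('X^n - 1 %| toL f * g_poly a).
Proof.
rewrite -Xn_sub1_dvd_g_poly -{1}[g_poly _](subrK (toL f * g_poly a)).
by rewrite dvdp_addr ?g_poly_frob_act.
Qed.

(* [mulX_g_poly] says that Frobenius multiplies [g_poly a] by the unit 'X modulo
   'X^n - 1, so it fixes the monic gcd, whose coefficients thus lie in F. *)
Lemma gcd_g_poly_over a :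
  exists2 D : {poly F}, D \is monic & toL D %= gcdp ('X^n - 1) (g_poly a).
Proof.
set N := 'X^n - 1; set G := gcdp N _.
have nzN : N != 0 by rewrite -size_poly_gt0 size_Xn_sub1.
have nzG : G != 0 by rewrite gcdp_eq0 negb_and nzN.
pose D := (lead_coef G)^-1 *: G.
have monD : D \is monic by rewrite monicE lead_coefZ mulVf ?lead_coef_eq0.
have eqDG : D %= G by rewrite eqp_scale ?invr_eq0 ?lead_coef_eq0.
have eqG : map_poly frob G %= G.
  rewrite /G gcdp_map frob_g_poly rmorphB /= map_polyXn rmorph1 -/N.
  have eqXN : coprimep N 'X.
    have -> : 'X = 'X - 0%:P :> {poly L} by rewrite subr0.
    rewrite coprimep_XsubC rootE !hornerE.
    by rewrite expr0n eqn0Ngt ext_dim_gt0 sub0r oppr_eq0 oner_eq0.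
  (* Adding a multiple of [N] does not change the gcd with [N], so [g_poly (frob a)] may be replaced
     by ['X * g_poly a]. *)
  apply: eqp_trans (Gauss_gcdpr _ eqXN); rewrite mulX_g_poly.
  by rewrite eqp_sym addrC -mul_polyC gcdp_addl_mul.
have fixD : map_poly frob D = D.
  apply/eqP; rewrite -eqp_monic ?monic_map //.
  by rewrite (eqp_trans _ (eqp_trans eqG _)) ?eqp_map // eqp_sym.
(* The elements of [L] fixed by the [q]-th power map are those of [F]. *)
have /polyOver1P[E defD] : D \is a polyOver 1%VS.
  apply/polyOverP => i; rewrite Fermat's_little_theorem dimv1 expn1.
  by rewrite -[in X in _ == X]fixD coef_map.
by exists E; rewrite -?(map_monic (in_alg L)) -defD.
Qed.

(* u is the order of a for the F[X]-module structure of L given by Frobenius. *)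
Lemma frob_order_exists a :
  exists u : {poly F},
    [/\ u \is monic, u %| 'X^n - 1, forall f, (frob_act f a == 0) = (u %| f)
      & ((size (gcdp ('X^n - 1)%R (g_poly a))).-1 + (size u).-1 = n)%N].
Proof.
have [D monD eqD] := gcd_g_poly_over a; set N := 'X^n - 1 : {poly L}.
have nzD : toL D != 0 by rewrite map_poly_eq0 monic_neq0.
have toLN : toL ('X^n - 1) = N by rewrite rmorphB /= map_polyXn rmorph1.
have monN : ('X^n - 1 : {poly F}) \is monic by rewrite monicXnsubC ?ext_dim_gt0.
have DdvN : D %| 'X^n - 1.
  by rewrite -(dvdp_map (in_alg L)) toLN (eqp_dvdl _ eqD) dvdp_gcdl.
have /dvdpP[u defN] := DdvN.
have monu : u \is monic by rewrite -(monicMr _ monD) -defN.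
exists u; split=> // [|f|]; first by rewrite defN dvdp_mulr.
  have /dvdpP[w defg] : toL D %| g_poly a by rewrite (eqp_dvdl _ eqD) dvdp_gcdr.
  rewrite frob_act_eq0 -/N -toLN defN rmorphM /= defg mulrA dvdp_mul2r //.
  (* Dividing [N] and [g_poly a] by their gcd [D] leaves coprime cofactors [u] and [w], so [u]
     divides [f * w] only if it divides [f]. *)
  rewrite Gauss_dvdpl ?dvdp_map //.
  have : toL D * 1 %= toL D * gcdp (toL u) w.
    rewrite mulr1 (eqp_trans eqD) // eqp_sym (eqp_trans (mulp_gcdr _ _ _)) //.
    by rewrite ![toL D * _]mulrC -defg -rmorphM /= -defN toLN eqpxx.
  by rewrite eqp_mul2l // /coprimep size_poly_eq1 eqp_sym.
rewrite -(eqp_size eqD) size_map_poly.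
have := congr1 (fun P : {poly F} => size P) defN.
rewrite size_XnsubC ?ext_dim_gt0 // size_mul ?monic_neq0 // => /eqP.
have := monic_neq0 monu; have := monic_neq0 monD; rewrite -!size_poly_eq0.
case: (size u) (size D) => [|x] [|y] //= _ _.
by rewrite addnS /= eqSS addnC => /eqP.
Qed.

(** The right side is the value at [a] of the linearized polynomial of [f], so that the kernel of
    [frob_act f] can be bounded by counting roots. *)
Lemma frob_actE f a : frob_act f a = \sum_(i < size f) f`_i *: a ^+ (q ^ i).
Proof.
rewrite -{1}[f]coefK poly_def /frob_act rmorph_sum /= sum_lfunE.
apply: eq_bigr => i _; rewrite linearZ /= mulr_algl scale_lfunE.
rewrite rmorphXn /= horner_algX; congr (_ *: _).
elim: {i}(i : nat) a => [|i IHi] a.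
  by rewrite expr0 id_lfunE expr1.
by rewrite exprS lfun_mulE IHi lfunE /= /frob -exprM -expnS.
Qed.

Lemma card_finvect_vspace (K : {vspace L}) :
  #|[pred a : finvect_type L | a \in K]| = (q ^ \dim K)%N.
Proof. exact: (card_vspace (K : {vspace finvect_type L})). Qed.

Lemma dim_frob_ker_le f : f != 0 -> (\dim (lker (frob_act f)) <= (size f).-1)%N.
Proof.
move=> nzf; have q_gt1 : (1 < q)%N by apply: finNzRing_gt1.
rewrite -(leq_exp2l _ _ q_gt1) -card_finvect_vspace; set K := [pred a | _].
pose R : {poly L} := \sum_(i < size f) (f`_i)%:A *: 'X^(q ^ i).
have rootR : all (root R) (enum K).
  apply/allP => a; rewrite (mem_enum K) inE memv_ker frob_actE => /eqP Ka.
  rewrite rootE horner_sum -[X in _ == X]Ka; apply/eqP/eq_bigr => i _.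
  by rewrite hornerZ hornerXn mulr_algl.
have sizeR : (size R <= (q ^ (size f).-1).+1)%N.
  apply: (leq_trans (size_sum _ _ _)); apply/bigmax_leqP => i _.
  apply: leq_trans (size_scale_leq _ _) _; rewrite size_polyXn ltnS.
  by rewrite leq_exp2l // -ltnS (ltn_predK (ltn_ord i)).
have nzR : R != 0.
  apply: contraNneq nzf => R0; rewrite -lead_coef_eq0 lead_coefE.
  (* The exponents [q ^ i] are distinct, so this coefficient of [R] is the leading coefficient of
     [f] alone. *)
  have := congr1 (fun P : {poly L} => P`_(q ^ (size f).-1)) R0.
  rewrite coef0 coef_sum.
  case sf: (size f) => [|m]; first by rewrite nth_default ?sf.
  rewrite big_ord_recr /= big1 ?add0r => [|i _].
    rewrite coefZ coefXn eqxx mulr1 => /eqP.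
    by rewrite scaler_eq0 oner_eq0 orbF.
  by rewrite coefZ coefXn eqn_exp2l // gtn_eqF ?mulr0.
have := max_poly_roots nzR rootR (enum_uniq _).
by rewrite -(cardE K) => lt_KR; rewrite -ltnS (leq_trans lt_KR).
Qed.

(* With h f = 'X^n - 1, the image of f(frob) lies in the kernel of h(frob), so
   the upper bounds for f and h on the kernel dimensions must both be sharp. *)
Lemma dim_frob_ker f : f %| 'X^n - 1 -> \dim (lker (frob_act f)) = (size f).-1.
Proof.
case/dvdpP=> h defN.
have := size_XnsubC (1 : F) ext_dim_gt0; rewrite polyC1 defN => sizeN.
have: h * f != 0 by rewrite -size_poly_gt0 sizeN.
rewrite mulf_eq0 negb_or => /andP[nzh nzf].
apply/eqP; rewrite eqn_leq dim_frob_ker_le //=.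
have im_h : (limg (frob_act f) <= lker (frob_act h))%VS.
  apply/subvP => _ /memv_imgP[a _ ->].
  rewrite memv_ker -frob_actM -defN frob_act_eq0 rmorphB /= map_polyXn rmorph1.
  by rewrite dvdp_mulr.
have := limg_ker_dim (frob_act f) fullv; rewrite capfv => dimE.
have := leq_trans (dimvS im_h) (dim_frob_ker_le nzh).
move: sizeN; rewrite size_mul // -(leq_add2l (\dim (lker (frob_act f)))) dimE.
have: (0 < size h)%N by rewrite size_poly_gt0.
have: (0 < size f)%N by rewrite size_poly_gt0.
case: (size f) (size h) => [|x] [|y] //= _ _; rewrite addnS /= => -[<-].
by rewrite [(y + x)%N]addnC leq_add2r.
Qed.

Lemma card_frob_ker f : f %| 'X^n - 1 ->
  #|[set a : finvect_type L | frob_act f a == 0]| = (q ^ (size f).-1)%N.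
Proof.
move=> dvf; rewrite -dim_frob_ker // -card_finvect_vspace.
by apply: eq_card => a; rewrite !inE memv_ker.
Qed.

End Frobenius.

(** * Monic divisors of [N] as products of powers of its irreducible factors *)

Section PolyFactors.

Variable F : finFieldType.
Implicit Types f u : {poly F}.

Lemma monic_irreducible_factor u : (1 < size u)%N ->
  exists g : {poly F}, [/\ g \is monic, irreducible_poly g & g %| u].
Proof.
elim: {u}_.+1 {-2}u (ltnSn (size u)) => // s IHs u su u_gt1.
have nzu : u != 0 by rewrite -size_poly_gt0 ltnW.
have [/irreducibleP irr_u | ] := boolP (irreducibleb u).
  have nzl : (lead_coef u)^-1 != 0 by rewrite invr_eq0 lead_coef_eq0.
  exists ((lead_coef u)^-1 *: u); split; last by rewrite dvdpZl.
    by rewrite monicE lead_coefZ mulVf ?lead_coef_eq0.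
  split=> [|d d_neq1]; first by rewrite size_scale ?u_gt1.
  rewrite dvdpZr // => /(irr_u.2 _ d_neq1)/eqp_trans; apply.
  by rewrite eqp_sym eqp_scale.
(* [irreducibleb] ranges over polynomials shorter than [u], so its failure yields a nonconstant
   divisor that is strictly smaller. *)
rewrite /irreducibleb u_gt1 /= => /forallPn[d].
rewrite negb_imply -ltnNge -Pdiv.Idomain.dvdpE => /andP[dvd_du d_gt1].
have lt_du : (size d < size u)%N.
  by rewrite -[ltnRHS]prednK ?(ltnW u_gt1) // ltnS size_npoly.
have [g [mon_g irr_g dvd_gd]] := IHs d (leq_trans lt_du su) d_gt1.
by exists g; split=> //; apply: dvdp_trans dvd_du.
Qed.

Variables (I : finType) (P : I -> {poly F}) (N : {poly F}) (m : nat).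
Hypothesis P_monic : forall i, P i \is monic.
Hypothesis P_irr : forall i, irreducible_poly (P i).
Hypothesis P_inj : injective P.
Hypothesis P_all : forall g, g \is monic -> irreducible_poly g -> g %| N ->
  exists i, g = P i.
Hypothesis P_mult : forall i, (P i ^+ m %| N) && ~~ (P i ^+ m.+1 %| N).

Local Notation prodP a := (\prod_i P i ^+ a i).

Lemma coprime_factors i j : i != j -> coprimep (P i) (P j).
Proof.
move=> neq_ij; rewrite irreducible_poly_coprime //; apply: contra neq_ij => dv.
have size_neq1 : size (P i) != 1%N by have [] := P_irr i; case: size => [|[]].
have := (P_irr j).2 _ size_neq1 dv.
by rewrite eqp_monic // => /eqP/P_inj->.
Qed.

(** The other factors are coprime to [P i], which leaves a comparison of two powers of [P i]. *)
Lemma factor_exp_dvd_prod (b : I -> nat) i e :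
  (P i ^+ e %| prodP b) = (e <= b i)%N.
Proof.
rewrite (bigD1 i) //= Gauss_dvdpl ?dvdp_Pexp2l //; first by case: (P_irr i).
apply: coprimep_expl; apply: (big_ind (coprimep (P i))) => [|f g cf cg|j ne].
- exact: coprimep1.
- by rewrite coprimepMr cf.
- by rewrite coprimep_expr // coprime_factors // eq_sym.
Qed.

Lemma prod_factors_dvd (a : I -> nat) u :
  (forall i, P i ^+ a i %| u) -> prodP a %| u.
Proof.
move=> dv; elim: index_enum (index_enum_uniq I) => [|i s IHs] /=.
  by rewrite big_nil dvd1p.
case/andP=> s'i /IHs dvs; rewrite big_cons Gauss_dvdp ?dv //.
apply: coprimep_expl; rewrite big_seq.
apply: (big_ind (coprimep (P i))) => [|f g cf cg|j sj].
- exact: coprimep1.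
- by rewrite coprimepMr cf.
- by rewrite coprimep_expr // coprime_factors //; apply: contraNneq s'i => ->.
Qed.

Lemma prod_factors_dvdE (a b : I -> nat) :
  (prodP a %| prodP b) = [forall i, (a i <= b i)%N].
Proof.
apply/idP/forallP=> [dv i | le_ab].
  rewrite -factor_exp_dvd_prod; apply: dvdp_trans dv.
  by rewrite factor_exp_dvd_prod.
by apply: prod_factors_dvd => i; rewrite factor_exp_dvd_prod.
Qed.

Lemma prod_factors_dvdN (a : {ffun I -> 'I_m.+1}) : prodP a %| N.
Proof.
apply: prod_factors_dvd => i; have /andP[dv _] := P_mult i.
by apply: dvdp_trans dv; rewrite dvdp_exp2l // -ltnS.
Qed.

(** Irreducible factors are split off one at a time; the exact multiplicity in [N] then caps every
    exponent at [m]. *)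
Lemma monic_divisor_prod u : u \is monic -> u %| N ->
  exists a : {ffun I -> 'I_m.+1}, u = prodP a.
Proof.
move=> monu uN; have [e def_u] : exists e : I -> nat, u = prodP e.
  elim: {u}_.+1 {-2}u (ltnSn (size u)) monu uN => // s IHs u su monu uN.
  have [u_le1 | u_gt1] := leqP (size u) 1.
    exists (fun=> 0%N); rewrite big1 //.
    by move: monu; rewrite (size1_polyC u_le1) monicE lead_coefC => /eqP->.
  have [g [mon_g irr_g /dvdpP[w def_u]]] := monic_irreducible_factor u_gt1.
  have wu : w %| u by rewrite def_u dvdp_mulr.
  have gu : g %| u by rewrite def_u dvdp_mull.
  have monw : w \is monic by rewrite -(monicMr _ mon_g) -def_u.
  have [i def_g] := P_all mon_g irr_g (dvdp_trans gu uN).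
  have lt_wu : (size w < size u)%N.
    rewrite def_u size_monicM ?monic_neq0 // -[X in (X < _)%N]addn0.
    case: (irr_g); case: (size g) => [|[|k]] // _ _.
    by rewrite !addnS ltnS addn0 leq_addr.
  have [e def_w] := IHs w (leq_trans lt_wu su) monw (dvdp_trans wu uN).
  exists (fun j => e j + (j == i))%N; rewrite def_u def_w def_g.
  under [RHS]eq_bigr do rewrite exprD.
  rewrite big_split /=; congr (_ * _).
  by rewrite (bigD1 i) //= eqxx expr1 big1 ?mulr1 // => j /negPf->.
have le_em i : (e i < m.+1)%N.
  rewrite ltnNge; have /andP[_] := P_mult i; apply: contra => lt_m_ei.
  apply: dvdp_trans uN; rewrite def_u.
  by rewrite factor_exp_dvd_prod.
exists [ffun i => Ordinal (le_em i)]; rewrite def_u.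
by apply: eq_bigr => i _; rewrite ffunE.
Qed.

Lemma size_prod_factors (a : I -> nat) :
  (size (prodP a)).-1 = (\sum_i (size (P i)).-1 * a i)%N.
Proof.
(* Degrees add only for nonzero factors, so monicity is carried through the induction. *)
have [] // : prodP a \is monic /\
  (size (prodP a)).-1 = (\sum_i (size (P i)).-1 * a i)%N.
apply: (big_rec2 (fun f k => f \is monic /\ (size f).-1 = k)).
  by rewrite monic1 size_poly1.
move=> i f k _ [monf <-].
have mon_e : P i ^+ a i \is monic by apply: monic_exp.
split; first by rewrite monicMr.
rewrite size_monicM ?monic_neq0 // -size_exp.
have := monic_neq0 mon_e; have := monic_neq0 monf; rewrite -!size_poly_gt0.
by case: (size f) => // x _; case: (size _) => // y _; rewrite addnS addSn.
Qed.
End PolyFactors.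

(** * Inversion over exponent tuples *)

(** For [j > 0] the summand is [Q ^ (w * j) - Q ^ (w * (j - 1))], so the sum telescopes. Over a
    field of [Q] elements it is the polynomial Euler function of the [j]-th power of an irreducible
    of degree [w]. *)
Lemma sum_prime_power_weights (Q w : nat) m (b : 'I_m.+1) : (0 < Q)%N ->
  (\sum_(j < m.+1 | j <= b)
     (if 0 < j then Q ^ (w * (j - 1)) * (Q ^ w - 1) else 1) = Q ^ (w * b))%N.
Proof.
move=> Q_gt0; case: b => b lt_bm /=.
pose f j := (if 0 < j then Q ^ (w * (j - 1)) * (Q ^ w - 1) else 1)%N.
rewrite (eq_bigl (fun j : 'I__ => true && (j < b.+1)%N)) //.
rewrite (big_ord_narrow_cond lt_bm) -(big_mkord predT f) big_mkcond.
elim: b {lt_bm} => [|b IHb]; first by rewrite big_nat1 muln0.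
rewrite big_nat_recr //= IHb /f /= subn1 mulnBr muln1.
by rewrite subnKC ?leq_pmulr ?expn_gt0 ?Q_gt0 // -expnD addnC -mulnS.
Qed.

(* Both sides have the same sums over the lower sets [b <= a], hence agree by
   induction on [a]; this replaces the multiplicativity of the polynomial
   Euler function. *)
Lemma card_order_eq (T I : finType) (m Q : nat) (w : I -> nat)
    (e : T -> {ffun I -> 'I_m.+1}) :
  (0 < Q)%N ->
  (forall b : {ffun I -> 'I_m.+1},
     #|[set t | [forall i, (e t i <= b i)%N]]| = (Q ^ (\sum_i w i * b i))%N) ->
  forall a : {ffun I -> 'I_m.+1},
    #|[set t | e t == a]| =
      (\prod_(i | 0 < a i) (Q ^ (w i * (a i - 1)) * (Q ^ w i - 1)))%N.
Proof.
move=> Q_gt0 card_le a.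
pose phi i (j : 'I_m.+1) :=
  if (0 < j)%N then (Q ^ (w i * (j - 1)) * (Q ^ w i - 1))%N else 1%N.
rewrite big_mkcond /= -/(\prod_i phi i (a i))%N.
have [s] := ubnP (\sum_i a i)%N; elim: s a => // s IHs a le_a.
have lhs : #|[set t | [forall i, (e t i <= a i)%N]]|
    = (\sum_(b : {ffun I -> 'I_m.+1} | [forall i, b i <= a i])
         #|[set t | e t == b]|)%N.
  rewrite -sum1_card.
  rewrite (partition_big e (fun b : {ffun _} => [forall i, (b i <= a i)%N])) /=;
    last by move=> t; rewrite inE.
  apply: eq_bigr => b le_ba; rewrite -sum1_card; apply: eq_bigl => t.
  by rewrite !inE andb_idl // => /eqP->.
(* Each factor [Q ^ (w i * a i)] is a telescoped sum over exponents at most [a i]; expanding the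
   product gives one term per tuple below [a]. *)
have rhs : (Q ^ (\sum_i w i * a i) =
    \sum_(b : {ffun I -> 'I_m.+1} | [forall i, b i <= a i])
      \prod_i phi i (b i))%N.
  rewrite expn_sum; under eq_bigr do rewrite -sum_prime_power_weights //.
  by rewrite bigA_distr_big_dep; apply: eq_bigl => b; apply/familyP/forallP.
move: (card_le a); rewrite lhs rhs.
have aa : [forall i, (a i <= a i)%N] by apply/forallP.
rewrite (bigD1 a) //= [RHS](bigD1 a) //=.
rewrite (eq_bigr (fun b : {ffun I -> 'I_m.+1} => \prod_i phi i (b i))%N).
  by move/addIn.
move=> b /andP[/forallP le_ba ne_ba]; apply: IHs.
rewrite -ltnS; apply: leq_trans le_a; rewrite ltnS ltn_neqAle leq_sum // andbT.
apply: contraNneq ne_ba => eq_sum; apply/eqP/ffunP => i; apply: val_inj => /=.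
apply/eqP; rewrite eqn_leq le_ba /= leqNgt; apply/negP => lt_i.
move/eqP: eq_sum; rewrite (bigD1 i) // [X in _ == X](bigD1 i) //= ltn_eqF //.
by rewrite -addSn leq_add // leq_sum.
Qed.

(** * Multiplicities and degrees of the irreducible factors of ['X^n - 1] *)

Section CyclicFactors.

Variables (F : finFieldType) (P : {poly F}).
Hypotheses (P_monic : P \is monic) (P_irr : irreducible_poly P).

Lemma irr_coprime_exp (f : {poly F}) k : P %| f ^+ k -> P %| f.
Proof.
apply: contraLR; rewrite -irreducible_poly_coprime // => /(coprimep_expr k).
by rewrite irreducible_poly_coprime.
Qed.

(** In characteristic [p], ['X^n - 1] is the [p ^ s]-th power of ['X^n0 - 1], which is separable
    because [p] does not divide [n0]. *)
Lemma irr_factor_mult (n p s n0 : nat) :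
  p \in [pchar F] -> n = (p ^ s * n0)%N -> coprime n0 p -> P %| 'X^n - 1 ->
  [/\ P %| 'X^n0 - 1, P ^+ (p ^ s) %| 'X^n - 1
    & ~~ (P ^+ (p ^ s).+1 %| 'X^n - 1)].
Proof.
move=> pF -> cop; set m := (p ^ s)%N.
have p_pr := pcharf_prime pF.
have -> : 'X^(m * n0) - 1 = ('X^n0 - 1) ^+ m :> {poly F}.
  have pm : [pchar {poly F}].-nat m.
    by rewrite pnatX pnatE ?(rmorph_pchar polyC) ?pF.
  by rewrite exprDn_pchar // exprNn_pchar // expr1n -exprM mulnC.
move=> PN; have P0 := irr_coprime_exp PN; split; rewrite ?dvdp_exp2r //.
have /dvdpP[w def0] := P0.
have : separable_poly ('X^n0 - 1 : {poly F}).
  apply: separable_Xn_sub_1.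
  by rewrite -(dvdn_pcharf pF) -prime_coprime // coprime_sym.
rewrite def0 separable_mul => /and3P[_ _ cop_wP].
have nzPm : P ^+ m != 0 by rewrite expf_neq0 ?monic_neq0.
(* Cancelling [P ^+ m] leaves [P] dividing a power of the cofactor [w], against separability. *)
rewrite exprMn exprS (dvdp_mul2r _ _ nzPm).
apply/negP=> PwX; have Pw := irr_coprime_exp PwX.
by move: cop_wP; rewrite coprimep_sym irreducible_poly_coprime // Pw.
Qed.

(* The q ^ d power map fixes the field K = F[X]/(P) of q ^ r elements, hence so
   does the q ^ (d %% r) one, whose fixed points are too few if r does not
   divide d. *)
Lemma irr_factor_degree_dvd (n0 d : nat) : (0 < d)%N ->
  (#|F| ^ d = 1 %[mod n0])%N -> P %| 'X^n0 - 1 -> ((size P).-1 %| d)%N.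
Proof.
move=> d_gt0 modd PN0; set q := #|F|; set r := (size P).-1.
have q_gt1 : (1 < q)%N by apply: finNzRing_gt1.
have mi : monic_irreducible_poly P by split.
pose K := {poly %/ P with mi}.
pose pi (f : {poly F}) : K := in_qpoly P f.
have piD f g : pi (f + g) = pi f + pi g by apply: in_qpolyD.
have piM f g : pi (f * g) = pi f * pi g by apply: in_qpolyM.
have pi1 : pi 1 = 1 by apply: in_qpoly1.
have piX f k : pi (f ^+ k) = pi f ^+ k.
  by elim: k => [|k IHk]; rewrite ?expr0 // !exprS piM IHk.
have hP : mk_monic P = P by apply: mk_monicE.
have piK (y : K) : pi (y : {poly F}) = y.
  by apply/val_inj/in_qpoly_small; rewrite size_mk_monic.
have x_n0 : pi 'X ^+ n0 = 1.
  rewrite -piX -(subrK 1 'X^n0) piD pi1 -[RHS]add0r; congr (_ + _).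
  apply/val_inj; rewrite /= -Pdiv.IdomainMonic.modpE ?monic_mk_monic // hP.
  exact/eqP.
have fix_x : pi 'X ^+ (q ^ d) = pi 'X.
  have qd_gt0 : (0 < q ^ d)%N by rewrite expn_gt0 ltnW.
  have : (n0 %| q ^ d - 1)%N by rewrite -eqn_mod_dvd ?modd.
  case/dvdnP=> t def_t; rewrite -(subnK qd_gt0) def_t addn1 exprSr mulnC.
  by rewrite exprM x_n0 expr1n mul1r.
(* The [q ^ d] power map is a ring morphism of [K] fixing constants and the class of ['X], which
   generate [K]. *)
have fix_pi f : pi f ^+ (q ^ d) = pi f.
  elim/poly_ind: f => [|f c IHf].
    by rewrite -piX expr0n expn_eq0 gtn_eqF // ltnW.
  rewrite piD exprDn_pchar ?pnat_card_pchar // piM exprMn IHf fix_x.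
  by rewrite -piX -polyC_exp expf_card_iter.
have fix_K (y : K) : y ^+ (q ^ d) = y by rewrite -(piK y) fix_pi.
have cardK : #|K| = (q ^ r)%N by apply: card_qfpoly.
(* Raising to the power [q ^ r = #|K|] is the identity on [K], so multiples of [r] can be removed
   from [d]. *)
have fix_rem (y : K) : y ^+ (q ^ (d %% r)) = y.
  rewrite -[RHS]fix_K [in RHS](divn_eq d r) expnD exprM mulnC expnM.
  congr (_ ^+ _); rewrite -cardK; elim: (d %/ r)%N => // t IHt.
  by rewrite expnSr exprM -IHt expf_card.
rewrite /dvdn; apply: contraT; rewrite -lt0n => rem_gt0.
pose R : {poly K} := 'X^(q ^ (d %% r)) - 'X.
have sizeR : size R = (q ^ (d %% r)).+1.
  rewrite size_polyDl ?size_polyN ?size_polyX size_polyXn // ltnS.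
  exact: leq_ltn_trans rem_gt0 (ltn_expl _ q_gt1).
have nzR : R != 0 by rewrite -size_poly_gt0 sizeR.
have rootR : all (root R) (enum K).
  by apply/allP => y _; rewrite rootE !hornerE fix_rem subrr.
have := max_poly_roots nzR rootR (enum_uniq _).
rewrite -cardE cardK sizeR ltnS leq_exp2l // leqNgt ltn_pmod //.
by rewrite /r; case: P_irr; case: (size P) => [|[]].
Qed.

End CyclicFactors.

(** The factors of each degree [r] dividing [d] are enumerated by ['I_(v r)]. This yields all of
    them, in the indexing by pairs that the tuples use, because every degree divides [d]. *)
Lemma irr_factor_family (F : finFieldType) (n d : nat) (v : nat -> nat) :
  (0 < d)%N ->
  (forall r, (0 < r)%N -> v r = num_irr_factors F n r) ->
  (forall g : {poly F}, irreducible_poly g -> g \is monic -> g %| 'X^n - 1 ->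
     ((size g).-1 %| d)%N) ->
  exists P : {r : divisor d & 'I_(v (val r))} -> {poly F},
    [/\ forall x, [/\ P x \is monic, irreducible_poly (P x)
                    & P x %| 'X^n - 1],
        forall x, (size (P x)).-1 = val (tag x),
        injective P
      & forall g, g \is monic -> irreducible_poly g -> g %| 'X^n - 1 ->
          exists x, g = P x].
Proof.
move=> d_gt0 vE deg_dvd.
pose S r := [set f : {poly_r.+1 F} |
  [&& (f : {poly F}) \is monic, irreducibleb (f : {poly F}),
      size (f : {poly F}) == r.+1 & (f : {poly F}) %| 'X^n - 1]].
have r_gt0 (r : divisor d) : (0 < val r)%N.
  by have := valP r; rewrite /= -dvdn_divisors // => /dvdn_gt0; apply.
have vS (r : divisor d) : v (val r) = #|S (val r)| by rewrite vE.
pose poly_of (x : {r : divisor d & 'I_(v (val r))}) :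
  {poly_(val (tag x)).+1 F} := enum_val (cast_ord (vS (tag x)) (tagged x)).
have poly_ofP x : poly_of x \in S (val (tag x)) by apply: enum_valP.
exists (fun x => val (poly_of x)); split=> [x|x||g mon_g irr_g gN].
- by have := poly_ofP x; rewrite inE => /and4P[? /irreducibleP ? _ ?].
- by have := poly_ofP x; rewrite inE => /and4P[_ _ /eqP-> _].
- move=> x y eq_xy; have eq_tag : tag x = tag y.
    have := poly_ofP x; have := poly_ofP y; rewrite !inE.
    move=> /and4P[_ _ /eqP size_y _] /and4P[_ _ /eqP size_x _].
    apply/val_inj/eqP; rewrite -eqSS -size_x -size_y; apply/eqP.
    exact: (congr1 (fun f : {poly F} => size f) eq_xy).
  case: x y eq_tag eq_xy => r i [s j] /= eq_rs; case: s / eq_rs j => j eq_ij.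
  by congr Tagged; apply/(@cast_ord_inj _ _ (vS r))/enum_val_inj/val_inj.
have r_dvd : (size g).-1 \in divisors d by rewrite -dvdn_divisors ?deg_dvd.
pose r : divisor d := SeqSub r_dvd.
have size_g : size g = (val r).+1.
  by rewrite /= prednK // size_poly_gt0 irredp_neq0.
have le_g : (size g <= (val r).+1)%N by rewrite size_g.
have Sg : NPoly le_g \in S (val r).
  by rewrite inE /= mon_g gN size_g eqxx !andbT; apply/irreducibleP.
exists (Tagged (fun r : divisor d => 'I_(v (val r)))
  (cast_ord (esym (vS r)) (enum_rank_in Sg (NPoly le_g)))).
by rewrite /poly_of /= cast_ordKV enum_rankK_in.
Qed.

(** * Counting [k]-normal elements by the exponents of their orders *)

Section FlatCount.

Variables (F : finFieldType) (L : fieldExtType F).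
Local Notation n := (\dim {:L}).
Variables (I : finType) (P : I -> {poly F}) (m k : nat).
Hypothesis P_monic : forall i, P i \is monic.
Hypothesis P_irr : forall i, irreducible_poly (P i).
Hypothesis P_inj : injective P.
Hypothesis P_all : forall g, g \is monic -> irreducible_poly g ->
  g %| 'X^n - 1 -> exists i, g = P i.
Hypothesis P_mult : forall i,
  (P i ^+ m %| 'X^n - 1) && ~~ (P i ^+ m.+1 %| 'X^n - 1).
Hypothesis lt_kn : (k < n)%N.

Let w i := (size (P i)).-1.

(** Each element is sent to the exponent tuple of its order. The elements with tuple below [b] form
    the kernel of the product with exponents [b], whose cardinality is known, so [card_order_eq]
    gives the size of each fibre. *)
Lemma num_knormal_exponents :
  num_knormal L k =
    (\sum_(a : {ffun I -> 'I_m.+1} | \sum_i w i * a i == n - k)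
       \prod_(i | 0 < a i) (#|F| ^ (w i * (a i - 1)) * (#|F| ^ w i - 1)))%N.
Proof.
have exP (t : finvect_type L) : exists a : {ffun I -> 'I_m.+1},
    (forall f : {poly F},
       (frob_act L f t == 0) = (\prod_i P i ^+ a i %| f)) /\
    is_knormal k (t : L) = (\sum_i w i * a i == n - k)%N.
  have [u [monu uN actE sizeE]] := frob_order_exists (t : L).
  have [a def_u] := monic_divisor_prod P_monic P_irr P_inj P_all P_mult monu uN.
  exists a; split=> [f|]; first by rewrite actE def_u.
  rewrite /is_knormal -(size_prod_factors P_monic) -def_u.
  (* The degrees of the gcd and of the order add up to [n]; [k < n] keeps the subtraction [n - k]
     from truncating. *)
  move: (size (gcdp _ _)).-1 (size u).-1 sizeE => x y sizeE.
  by move: lt_kn; rewrite -sizeE => lt_k; apply/eqP/eqP; lia.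
have [e eP] := fin_all_exists exP.
have q_gt0 : (0 < #|F|)%N by apply/ltnW/finNzRing_gt1.
have card_e := @card_order_eq _ _ m #|F| w e q_gt0.
rewrite /num_knormal -sum1_card.
rewrite (partition_big e (fun a => \sum_i w i * a i == n - k)%N) /=; last first.
  by move=> t; rewrite inE; case: (eP t) => _ ->.
apply: eq_bigr => a wa; rewrite -card_e => [|b].
  rewrite -sum1_card; apply: eq_bigl => t; rewrite !inE.
  by case: (eP t) => _ ->; rewrite andb_idl // => /eqP->.
have bN := prod_factors_dvdN P_monic P_irr P_inj P_mult b.
rewrite -(size_prod_factors P_monic) -(card_frob_ker bN).
apply: eq_card => t; rewrite !inE; case: (eP t) => -> _.
by rewrite prod_factors_dvdE.
Qed.

End FlatCount.

(** * Reindexing sums over tuples *)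

(** Currying turns functions on the pairs [(r, i)] into families of functions of [i] indexed by
    [r]. *)
Lemma pair_tuples_flatten (d m w : nat) (v : nat -> nat)
    (G : nat -> nat -> nat) :
  (\sum_(a : {ffun {r : divisor d & 'I_(v (val r))} -> 'I_m.+1}
           | \sum_x val (tag x) * a x == w)
     \prod_(x | 0 < a x) G (val (tag x)) (a x) =
   \sum_(a in pair_tuples d m w v)
     \prod_(r : divisor d) \prod_(i < v (val r) | 0 < a r i)
       G (val r) (a r i))%N.
Proof.
pose I := {r : divisor d & 'I_(v (val r))}.
pose to (a : pair_tuple d m v) : {ffun I -> 'I_m.+1} :=
  [ffun x => a (tag x) (tagged x)].
pose from (a : {ffun I -> 'I_m.+1}) : pair_tuple d m v :=
  [ffun r => [ffun i => a (Tagged (fun r : divisor d => 'I_(v (val r))) i)]].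
have fromK : cancel from to.
  by move=> a; apply/ffunP => -[r i]; rewrite !ffunE.
have toK : cancel to from.
  move=> a; apply/ffunP => r; rewrite ffunE.
  by apply/ffunP => i; rewrite !ffunE.
rewrite (reindex to); last by exists from => a _; [apply: toK | apply: fromK].
apply: eq_big => [a | a _].
  rewrite inE; congr (_ == _); apply/esym.
  under [LHS]eq_bigr => r _ do rewrite big_distrr.
  rewrite (sig_big_dep predT (fun r => predT)
    (fun r (i : 'I_(v (val r))) => val r * a r i)%N) /=.
  by apply: eq_bigr => x _; rewrite ffunE.
rewrite (sig_big_dep predT (fun r (i : 'I_(v (val r))) => 0 < a r i)%N
  (fun r (i : 'I_(v (val r))) => G (val r) (a r i))) /=.
by apply: eq_big => [x | x _]; rewrite ffunE.
Qed.

(** Distributivity when the type of the choices depends on [i]: dependent tuples are encoded as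
    functions into a tagged union, where the non-dependent law applies. *)
Lemma bigA_distr_dffun (I : finType) (T_ : I -> finType)
    (Q : forall i, pred (T_ i)) (F : forall i, T_ i -> nat) :
  (\prod_i \sum_(x | Q i x) F i x =
   \sum_(a : {dffun forall i, T_ i} | [forall i, Q i (a i)])
     \prod_i F i (a i))%N.
Proof.
(* Extension by zero moves the filter into the summand: a tuple violating [Q] at one index gets a
   zero factor. *)
pose G i := [ffun x : T_ i => if Q i x then F i x else 0%N].
rewrite [RHS]big_mkcond (reindex (@dffun_of_fprod _ T_)) /=; last first.
  by exists (@fprod_of_dffun _ T_) => a _;
    [apply: dffun_of_fprodK | apply: fprod_of_dffunK].
transitivity (\sum_(t : fprod T_) \prod_i G i (t i))%N.
  rewrite (big_fprod 1%N _ G); etransitivity; last first.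
    exact: (bigA_distr_big_dep (fun i => tagged_with T_ i)
      (fun i => untag 0%N (G i))).
  apply: eq_bigr => i _.
  transitivity (\sum_x G i x)%N; last exact: (big_tag (fun i x => G i x) i).
  by rewrite big_mkcond; apply: eq_bigr => x _; rewrite ffunE.
apply: eq_bigr => t _; case: ifPn => [/forallP Qt | /forallPn[i Qi]].
  by apply: eq_bigr => i _; have := Qt i; rewrite !ffunE => ->.
by rewrite (bigD1 i) //=; move: Qi; rewrite !ffunE => /negPf->; rewrite mul0n.
Qed.

(** A 0-1 vector of sum [b] is the indicator of a [b]-element subset. On its support [c i - 1] is
    zero, so its product is [x ^ b]. *)
Lemma sum_draws_weights (Q w x u b : nat) :
  (\sum_(c : {ffun 'I_u -> 'I_2} | \sum_i c i == b)
     \prod_(i < u | 0 < c i) (Q ^ (w * (c i - 1)) * x) = 'C(u, b) * x ^ b)%N.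
Proof.
have le1 (c : {ffun 'I_u -> 'I_2}) i : (c i <= 1)%N by rewrite -ltnS.
have sumE (c : {ffun 'I_u -> 'I_2}) : (\sum_i c i = #|[set i | 0 < c i]|)%N.
  rewrite -sum1dep_card [RHS]big_mkcond; apply: eq_bigr => i _.
  by have := le1 c i; case: (c i : nat) => [|[]].
pose f (A : {set 'I_u}) := [ffun i => inord (i \in A) : 'I_2].
have fE A i : (0 < f A i)%N = (i \in A).
  by rewrite ffunE inordK //; case: (i \in A).
rewrite (reindex f); last first.
  exists (fun c : {ffun 'I_u -> 'I_2} => [set i | 0 < c i]%N) => [A _ | c _].
    by apply/setP => i; rewrite inE fE.
  apply/ffunP => i; apply/val_inj; rewrite ffunE /= inordK ?inE //.
    by have := le1 c i; case: (c i : nat) => [|[]].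
  by case: (0 < _)%N.
transitivity (\sum_(A : {set 'I_u} | #|A| == b) x ^ b)%N.
  apply: eq_big => A; rewrite sumE.
    by congr (_ == _); apply: eq_card => i; rewrite inE fE.
  move/eqP=> cardA; rewrite -cardA -prod_nat_const.
  apply: eq_big => i; rewrite ?inE // => f_gt0.
  have -> : (f A i : nat) = 1%N by apply/eqP; rewrite eqn_leq le1.
  by rewrite subnn muln0 mul1n.
by rewrite sum_nat_const -cardsE card_draws card_ord.
Qed.

(* When all exponents are 0 or 1, a tuple is grouped by the number of factors
   of each degree that it selects. *)
Lemma sum_pair_tuples1 (d w Q : nat) (v : nat -> nat) :
  (\sum_(a in pair_tuples d 1 w v)
     \prod_(r : divisor d) \prod_(i < v (val r) | 0 < a r i)
       (Q ^ (val r * (a r i - 1)) * (Q ^ val r - 1)) =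
   \sum_(b in div_tuples d w v)
     \prod_(r : divisor d) ('C(v (val r), b r) * (Q ^ val r - 1) ^ b r))%N.
Proof.
pose cnt (a : pair_tuple d 1 v) : div_tuple d v :=
  [ffun r => inord (\sum_i a r i)%N].
(* The entries are at most 1, so their sum is at most [v (val r)] and [inord] does not fall back to
   its default. *)
have cntE a r : cnt a r = (\sum_i a r i)%N :> nat.
  rewrite ffunE inordK // ltnS -[leqRHS]card_ord -sum1_card.
  by apply: leq_sum => i _; rewrite -ltnS.
rewrite (partition_big cnt (fun b => b \in div_tuples d w v)) /=; last first.
  move=> a; rewrite !inE => /eqP <-; apply/eqP.
  by apply: eq_bigr => r _; rewrite cntE.
apply: eq_bigr => b; rewrite inE => /eqP wb.
(* Each binomial term becomes a sum over 0-1 vectors; the product of these sums is a sum over the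
   fibre of [cnt] at [b]. *)
under [RHS]eq_bigr => r _ do rewrite -(sum_draws_weights Q (val r)).
rewrite bigA_distr_dffun; apply: eq_bigl => a; rewrite inE.
apply/andP/forallP => [[_ /eqP <-] r | eq_ab]; first by rewrite cntE.
have {}eq_ab r : (\sum_i a r i = b r)%N by apply/eqP.
split; first by rewrite -wb; apply/eqP/eq_bigr => r _; rewrite eq_ab.
by apply/eqP/ffunP => r; apply/ord_inj; rewrite cntE eq_ab.
Qed.

Lemma dvdn_pchar_card (F : finFieldType) p : p \in [pchar F] -> (p %| #|F|)%N.
Proof.
move=> pF; have := pnat_card_pchar F^o 1; rewrite expn1.
rewrite (eq_pnat _ (pcharf_eq pF)) => /p_natP[[|e] cardF].
  by have := finNzRing_gt1 F; rewrite cardF.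
by rewrite cardF expnS dvdn_mulr.
Qed.

(* The two counting formulas *)
Local Close Scope ring_scope.

Theorem theorem3p2 (F : finFieldType) (L : fieldExtType F) (q p n s n0 k d : nat)
  (v : nat -> nat)
  (hq : q = #|F|) (hp : p \in [pchar F]%R) (hn : n = \dim {:L})
  (hn0 : n = p ^ s * n0) (hcop : coprime n0 p) (hk : k < n)
  (hd_gt0 : 0 < d) (hd : q ^ d = 1 %[mod n0])
  (hd_min : forall e, 0 < e -> q ^ e = 1 %[mod n0] -> d <= e)
  (hv : forall r, 0 < r -> v r = num_irr_factors F n r) :
  num_knormal L k =
    \sum_(a in pair_tuples d (p ^ s) (n - k) v)
      \prod_(r : divisor d) \prod_(i < v (val r) | 0 < a r i)
        (q ^ (val r * (a r i - 1)) * (q ^ val r - 1))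
  /\ (coprime n q ->
      num_knormal L k =
        \sum_(a in div_tuples d (n - k) v)
          \prod_(r : divisor d) ('C(v (val r), a r) * (q ^ val r - 1) ^ a r)).
Proof.
set m := p ^ s in hn0 *.
have main : num_knormal L k =
    \sum_(a in pair_tuples d m (n - k) v)
      \prod_(r : divisor d) \prod_(i < v (val r) | 0 < a r i)
        (q ^ (val r * (a r i - 1)) * (q ^ val r - 1)).
  have mult (g : {poly F}) (mg : g \is monic) (ig : irreducible_poly g) :=
    irr_factor_mult mg ig hp hn0 hcop.
  have [g ig mg gN|P [PP degP P_inj P_all]] := irr_factor_family hd_gt0 hv.
    have [gN0 _ _] := mult g mg ig gN.
    by apply: (irr_factor_degree_dvd mg ig hd_gt0 _ gN0); rewrite -hq.
  subst q; rewrite -(pair_tuples_flatten _ _ _ _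
    (fun r j => #|F| ^ (r * (j - 1)) * (#|F| ^ r - 1))).
  rewrite hn in hk P_all PP mult *.
  rewrite (@num_knormal_exponents _ _ _ P m) //; try by move=> x; case: (PP x).
    apply: eq_big => [a | a _]; last by apply: eq_bigr => x _; rewrite degP.
    by congr (_ == _); apply: eq_bigr => x _; rewrite degP.
  by move=> x; have [mx ix xN] := PP x; have [_ -> ->] := mult _ mx ix xN.
split=> // cop_nq; rewrite main.
(* If [s > 0], then [p] divides both [n] and [q], against coprimality; hence all exponents are 0 or
   1. *)
suff -> : m = 1 by apply: sum_pair_tuples1.
rewrite /m; case: s @m hn0 {main} => // s' m hn0.
have p_pr := pcharf_prime hp.
have pn : p %| n by rewrite hn0 /m expnS -mulnA dvdn_mulr.
have pq : p %| q by rewrite hq dvdn_pchar_card.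
have := dvdn_gcd p n q; rewrite pn pq (eqP cop_nq) dvdn1.
by case: (p) p_pr => [|[]].
Qed.
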